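(* Let $\mathfrak{TD}$ be a transition diagram for a zigzag filtration of block decompositions on a finite $T_0$ space $X$, let $\mathbb P$ be the partial order induced by $\mathfrak{TD}$, and let $Q$ be the quiver formed by the Hasse diagram of $\mathbb P$. Let $I$ be the ideal of the path algebra $kQ$ generated by all two-arrow paths forming AR-splits in $\mathfrak{TD}$, i.e. the paths consisting of $(N_1,N_0)\to(N_2,N_0)$ followed by $(N_2,N_0)\to(N_2,N_1)$ for an index triple $N_0\subset N_1\subset N_2$ used in $\mathfrak{TD}$. Then $(Q,I)$ is a gentle algebra.
   Context: Multivector fields. $X$ is a finite $T_0$ topological space; $\operatorname{mo}A=\operatorname{cl}A\setminus A$; $A$ is locally closed if $\operatorname{mo}A$ is closed. Homology has coefficients in a fixed field $k$. A multivector field $\mathcal V$ on $X$ is a partition of $X$ into locally closed sets (multivectors); $[x]_{\mathcal V}$ is the multivector containing $x$; a multivector $V$ is regular if $H(\operatorname{cl}V,\operatorname{mo}V)=0$, otherwise critical. $F_{\mathcal V}(x)=\operatorname{cl}\{x\}\cup[x]_{\mathcal V}$ and $F_{\mathcal V}(A)=\bigcup_{x\in A}F_{\mathcal V}(x)$. A solution is a map $\rho:I\to X$ on a $\mathbb Z$-interval with $\rho(t+1)\in F_{\mathcal V}(\rho(t))$; a path is a solution with bounded domain (single points are paths). A full solution $\varphi:\mathbb Z\to X$ is essential if for every $t$ there are $s>t$ and $s'<t$ such that for each $r\in\{s,s'\}$: $[\varphi(r)]_{\mathcal V}\ne[\varphi(t)]_{\mathcal V}$ or $[\varphi(r)]_{\mathcal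 V}$ is critical. $\operatorname{Inv}_{\mathcal V}A$ is the set of $x\in A$ lying on an essential solution with image in $A$. $N\subset X$ is an isolating block if $x,z\in N$, $y\in F_{\mathcal V}(x)$, $z\in F_{\mathcal V}(y)$ imply $y\in N$. Block decompositions. For a full solution, $\operatorname{uim}^-\varphi=\bigcap_{t<0}\varphi((-\infty,t])$, $\operatorname{uim}^+\varphi=\bigcap_{t>0}\varphi([t,\infty))$. A block decomposition of $S\subset X$ in $\mathcal V$ is a family $\mathcal B=\{B_p\}_{p\in P}$ of mutually disjoint non-empty isolating blocks (in $S$) admitting a partial order on $P$ such that (B1) every essential $\varphi$ in $S$ has $\operatorname{uim}^-\varphi\subset B_p$, $\operatorname{uim}^+\varphi\subset B_q$ for some $p,q$; (B2) if a path in $S$ starts in $B_p$ and ends in $B_q$ then either $p>q$, or $p=q$ and the path stays in $B_p$. The least such order is the flow induced order. ''For $\mathcal V$'' means of $X$ in $\mathcal V$. Write $(\mathcal B,\mathcal V)\sqsubseteq(\mathcal B',\mathcal V')$ if every multivector of $\mathcal V$ is contained in one of $\mathcal V'$ and every block of $\mathcal B$ is contained in one of $\mathcal B'$; the indexing map $\iota:P\to P'$ is given by $B_p\subset B'_{\iota(p)}$. A zigzag filtration of block decompositions is a sequence $\mathfrak B=\{(\mathcal B_\lambda,\mathcal V_\lambda)\}_{\lambda=0}^T$, with $\mathcal B_\lambda=\{B_{p,\lambda}\}_{p\in P_\lambda}$ a block decomposition for $\mathcal V_\lambda$ and consecutive terms related by $\sqsubseteq$ or $\sqsupseteq$. It is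 basic if all fibres of all indexing maps have at most 2 elements. Index pairs and triples. Closed sets $E\subset P$ form an index pair $(P,E)$ for $S$ in $\mathcal V$ if $F_{\mathcal V}(P\setminus E)\subset P$, $F_{\mathcal V}(E)\cap P\subset E$, $S=\operatorname{Inv}_{\mathcal V}(P\setminus E)$. Given a block decomposition $\{B_a,B_r\}$, $r\not<a$, of an isolating block $B$ in $\mathcal V$, an index triple is a triple of closed sets $N_0\subset N_1\subset N_2$ such that $(N_1,N_0)$, $(N_2,N_1)$, $(N_2,N_0)$ are index pairs for $\operatorname{Inv}B_a,\operatorname{Inv}B_r,\operatorname{Inv}B$ and $B_a\subset N_1\setminus N_0$, $B_r\subset N_2\setminus N_1$, $B\subset N_2\setminus N_0$. Its AR-split diagram consists of the inclusions $i:(N_1,N_0)\to(N_2,N_0)$, $j:(N_2,N_0)\to(N_2,N_1)$ and the (vertical) composite. Connecting sequence. Let $\operatorname{pf}_{\mathcal V}(A,Y)$ be the set of endpoints of paths in $Y$ starting in $A$. If $(P,E)$, $(P',E')$ are index pairs for $S$ and $B$ is an isolating block with $\operatorname{Inv}B=S$, $B\subset(P\setminus E)\cap(P'\setminus E')$, the connecting sequence is $(P,E)\supset(\operatorname{pf}(\operatorname{cl}B,P),E\cap\operatorname{pf}(\operatorname{mo}B,P))\subset(\operatorname{pf}(\operatorname{cl}B,P),\operatorname{pf}(\operatorname{mo}B,P))\supset(\operatorname{cl}B,\operatorname{mo}B)$ followed by the mirror image of the analogous sequence from $(P',E')$; all terms are index pairs for $S$. Transition diagram of a basic $\mathfrak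 B$. (1) Transition step: for each $\lambda$ with $(\mathcal B_\lambda,\mathcal V_\lambda)\sqsubseteq(\mathcal B_{\lambda+1},\mathcal V_{\lambda+1})$ and each $q\in P_{\lambda+1}$: if $\iota^{-1}(q)=\{p_0,p_1\}$, choose an index triple for the block decomposition $\{B_{p_0,\lambda},B_{p_1,\lambda}\}$ of $B_{q,\lambda+1}$ in $\mathcal V_\lambda$ with $(N_2,N_0)$ also an index pair for $\operatorname{Inv}_{\mathcal V_{\lambda+1}}B_{q,\lambda+1}$ in $\mathcal V_{\lambda+1}$; put $(N_1,N_0)$, $(N_2,N_1)$ in the column of $\mathcal B_\lambda$ and $(N_2,N_0)$ in the column of $\mathcal B_{\lambda+1}$, with the arrows of the AR-split diagram. If $\iota^{-1}(q)=\{p\}$, choose a common index pair $(P,E)$ for $\operatorname{Inv}_{\mathcal V_{\lambda+1}}B_{q,\lambda+1}$ in $\mathcal V_{\lambda+1}$ and $\operatorname{Inv}_{\mathcal V_\lambda}B_{p,\lambda}$ in $\mathcal V_\lambda$ with $B_{q,\lambda+1}\subset P\setminus E$, placed in both columns and joined by equality (one arrow). If $\iota^{-1}(q)=\emptyset$, choose an index pair $(P,E)$ for $\operatorname{Inv}_{\mathcal V_{\lambda+1}}B_{q,\lambda+1}$ with $B_{q,\lambda+1}\subset P\setminus E$. The case $\sqsupseteq$ is symmetric (roles of $\lambda$ and $\lambda+1$ exchanged). (2) Aligning step: each block with $0<\lambda<T$ has received two index pairs, one from each side; they are joined by a connecting sequence, whose terms occupy additional successive columns. Equal pairs at different positions are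 different nodes. Non-basic $\mathfrak B$. Each step $(\mathcal B_\lambda,\mathcal V_\lambda)\sqsubseteq(\mathcal B_{\lambda+1},\mathcal V_{\lambda+1})$ is replaced by an AR-cascade: a basic filtration $(\mathcal B_\lambda,\mathcal V_\lambda)\sqsubseteq(\mathcal B_{\lambda''},\mathcal V_\lambda)\sqsubseteq\dots\sqsubseteq(\mathcal B_{\lambda^{(n)}},\mathcal V_\lambda)\sqsubseteq(\mathcal B_{\lambda+1},\mathcal V_{\lambda+1})$; symmetrically for $\sqsupseteq$. A transition diagram for $\mathfrak B$ is one for such a basic zigzag filtration. The digraph of $\mathfrak{TD}$ (arrows given by the inclusions) is acyclic; its transitive closure is the induced partial order $\mathbb P$. The Hasse diagram is a quiver with arrows directed along inclusions. Gentle algebras. Paths in a quiver are written with the first arrow first. $(Q,I)$ is a bound quiver if $Q$ is finite and $R^m\subseteq I\subseteq R^2$ for some $m$, where $R$ is the ideal of $kQ$ generated by all arrows. A bound quiver $(Q,I)$ is called a gentle algebra if: (1) each node is the source of at most two arrows and the target of at most two arrows; (2) for each arrow $\alpha$ there is at most one arrow $\beta$ and at most one arrow $\gamma$ such that the paths $\alpha\beta$ and $\gamma\alpha$ (composable) are not in $I$; (3) for each arrow $\alpha$ there is at most one arrow $\beta$ and at most one arrow $\gamma$ such that the (composable) paths $\alpha\beta$ and $\gamma\alpha$ are in $I$; (4) $I$ is generated by paths of length two. *)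

(* Defs.v *)
From HB Require Import structures.
From mathcomp Require Import all_boot all_order all_algebra.
From mathcomp Require Import boolp classical_sets functions cardinality fsbigop.
From mathcomp Require Import reals topology.

Set Implicit Arguments.
Unset Strict Implicit.
Unset Printing Implicit Defensive.

Import Order.TTheory GRing.Theory Num.Theory.
Import numFieldTopology.Exports.

Local Open Scope classical_set_scope.
Local Open Scope ring_scope.

Section Ideals.
Context {A : pzRingType}.
Implicit Types I J : set A.

Definition is_ideal J : Prop :=
  [/\ J 0, (forall x y, J x -> J y -> J (x + y))
    & (forall a x, J x -> J (a * x) /\ J (x * a))].

Definition ideal_gen (G : set A) : set A := smallest is_ideal G.

Definition ideal_mul I J : set A :=
  ideal_gen [set z | exists x y, [/\ I x, J y & z = x * y]].

(* The zeroth power is the whole ring. *)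
Definition ideal_exp J (m : nat) : set A := iter m (ideal_mul J) setT.

End Ideals.

Record quiver := Quiver {
  qnode : finType;
  qarrow : finType;
  qsrc : qarrow -> qnode;
  qtgt : qarrow -> qnode }.

Section Paths.
Variable Q : quiver.

Fixpoint walk (x : qnode Q) (s : seq (qarrow Q)) : bool :=
  if s is a :: s' then (qsrc a == x) && walk (qtgt a) s' else true.

Definition walk_end (x : qnode Q) (s : seq (qarrow Q)) : qnode Q :=
  last x (map (@qtgt Q) s).

(* A path is a starting node with the list of its arrows, first arrow first;
   the node is needed to tell the trivial paths apart. *)
Record qpath := QPath {
  qpath_val : qnode Q * seq (qarrow Q);
  _ : walk qpath_val.1 qpath_val.2 }.
HB.instance Definition _ := [isSub for qpath_val].
HB.instance Definition _ := [Choice of qpath by <:].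

Definition pstart (p : qpath) : qnode Q := (val p).1.
Definition parrows (p : qpath) : seq (qarrow Q) := (val p).2.

Lemma walk_cat x s t : walk x (s ++ t) = walk x s && walk (walk_end x s) t.
Proof. by elim: s x => //= a s IH x; rewrite IH andbA. Qed.

Lemma walk_end_cat x s t : walk_end x (s ++ t) = walk_end (walk_end x s) t.
Proof. by rewrite /walk_end map_cat last_cat. Qed.

Lemma walk1 (a : qarrow Q) : walk (qsrc a) [:: a].
Proof. by rewrite /= eqxx. Qed.

Lemma walk_ptake i (p : qpath) : walk (pstart p) (take i (parrows p)).
Proof.
by move: (valP p); rewrite -{1}(cat_take_drop i (val p).2) walk_cat => /andP[].
Qed.

Lemma walk_pdrop i (p : qpath) :
  walk (walk_end (pstart p) (take i (parrows p))) (drop i (parrows p)).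
Proof.
by move: (valP p); rewrite -{1}(cat_take_drop i (val p).2) walk_cat => /andP[].
Qed.

Definition parrow (a : qarrow Q) : qpath := @QPath (qsrc a, [:: a]) (walk1 a).
Definition ptake i (p : qpath) : qpath :=
  @QPath (pstart p, take i (parrows p)) (walk_ptake i p).
Definition pdrop i (p : qpath) : qpath :=
  @QPath (walk_end (pstart p) (take i (parrows p)), drop i (parrows p))
    (walk_pdrop i p).
Definition plength (p : qpath) : nat := size (parrows p).

Lemma qpathP (p q : qpath) :
  pstart p = pstart q -> parrows p = parrows q -> p = q.
Proof.
rewrite /pstart /parrows => e1 e2; apply: val_inj.
by rewrite [LHS]surjective_pairing [RHS]surjective_pairing e1 e2.
Qed.

Lemma ptake_take i j p : (i <= j)%N -> ptake i (ptake j p) = ptake i p.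
Proof. by move=> ij; apply: qpathP; rewrite // /parrows /= take_takel. Qed.

Lemma pdrop_take i j p : pdrop i (ptake (i + j) p) = ptake j (pdrop i p).
Proof.
apply: qpathP; rewrite /pstart /parrows /=; first by rewrite take_takel ?leq_addr.
by rewrite take_drop addnC.
Qed.

Lemma pdrop_drop i j p : pdrop j (pdrop i p) = pdrop (i + j) p.
Proof.
apply: qpathP; rewrite /pstart /parrows /=; last by rewrite drop_drop addnC.
by rewrite -walk_end_cat takeD.
Qed.

End Paths.

Lemma sum_triangle (V : nmodType) (n : nat) (F : nat -> nat -> V) :
  \sum_(0 <= i < n.+1) \sum_(0 <= j < (n - i).+1) F i (i + j)%N =
  \sum_(0 <= l < n.+1) \sum_(0 <= i < l.+1) F i l.
Proof.
elim: n => [|n IH]; first by rewrite !big_nat1.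
rewrite [RHS]big_nat_recr //= -IH big_nat_recr //= subnn big_nat1 addn0.
rewrite [X in _ = _ + X]big_nat_recr //= addrA; congr (_ + _).
rewrite -big_split /=; apply: eq_big_nat => i /andP[_ /ltnSE le_in].
by rewrite subSn // big_nat_recr //= addnS subnKC.
Qed.

Section PathAlgebra.
Variables (k : fieldType) (Q : quiver).

Definition fin_supp : {pred qpath Q -> k^o} :=
  [pred f : qpath Q -> k^o | `[< finite_set [set p | f p != 0] >]].

Lemma fin_suppP (f : qpath Q -> k^o) :
  reflect (finite_set [set p | f p != 0]) (f \in fin_supp).
Proof. exact: asboolP. Qed.

Fact fin_supp_submod : submod_closed fin_supp.
Proof.
split=> [|c f g /fin_suppP ff /fin_suppP fg]; apply/fin_suppP.
  by apply: sub_finite_set (finite_set0 _) => p /=; rewrite eqxx.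
have fU : finite_set ([set p | f p != 0] `|` [set p | g p != 0]).
  by rewrite finite_setU.
apply: sub_finite_set fU => p /= nz.
have [f0|] := eqVneq (f p) 0; last by left.
right; apply: contra_neq nz => g0.
by rewrite /GRing.add /= /GRing.scale /= f0 g0 scaler0 addr0.
Qed.
HB.instance Definition _ :=
  GRing.isSubmodClosed.Build k (qpath Q -> k^o) fin_supp fin_supp_submod.

(* Finitely supported k-valued functions on the set of paths; [f p] is the
   coefficient of [p]. *)
Record path_alg := PathAlg {
  pa_coef :> qpath Q -> k^o;
  _ : pa_coef \in fin_supp }.
HB.instance Definition _ := [isSub for pa_coef].
HB.instance Definition _ := [Choice of path_alg by <:].
HB.instance Definition _ := [SubChoice_isSubLmodule of path_alg by <:].
Implicit Types f g h : path_alg.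

Lemma pa_eq f g : (forall p, f p = g p) -> f = g.
Proof. by move=> fg; apply/val_inj/funext. Qed.

Lemma pa_finite f : finite_set [set p | f p != 0].
Proof. by apply/fin_suppP; case: f. Qed.

Lemma pa_coefD f g p : (f + g) p = f p + g p. Proof. by []. Qed.

Lemma pa_coefZ c f p : (c *: f) p = c * f p. Proof. by []. Qed.

Fact pbasis_fin (p : qpath Q) :
  (fun q : qpath Q => (p == q)%:R : k^o) \in fin_supp.
Proof.
apply/fin_suppP; apply: sub_finite_set (finite_set1 p) => q /=.
by case: (eqVneq p q) => [->//|_]; rewrite eqxx.
Qed.
Definition pbasis (p : qpath Q) : path_alg := PathAlg (pbasis_fin p).

Fact pa_one_fin :
  (fun p : qpath Q => (plength p == 0)%N%:R : k^o) \in fin_supp.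
Proof.
apply/fin_suppP.
have fQ : finite_set (val @^-1` ((fun x : qnode Q => (x, [::])) @` setT)
    : set (qpath Q)).
  by apply: finite_preimage; [move=> p q _ _; exact: val_inj
                             |exact/finite_image/finite_finset].
apply: sub_finite_set fQ => p /=.
case: (eqVneq (plength p) 0) => [/size0nil ep _|_]; last by rewrite eqxx.
by exists (pstart p); rewrite // -ep -surjective_pairing.
Qed.
Definition pa_one : path_alg := PathAlg pa_one_fin.

(* The coefficient of [p] in a product is the sum over the factorizations of
   [p] into two consecutive paths. *)
Definition pa_conv f g (p : qpath Q) : k^o :=
  \sum_(0 <= i < (plength p).+1) f (ptake i p) * g (pdrop i p).

Fact pa_conv_fin f g : pa_conv f g \in fin_supp.
Proof.
apply/fin_suppP.
have ffg : finite_set (val @^-1` ((fun u : qpath Q * qpath Q =>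
    (pstart u.1, parrows u.1 ++ parrows u.2)) @`
    ([set p | f p != 0] `*` [set p | g p != 0])) : set (qpath Q)).
  apply: finite_preimage; first by move=> p q _ _; exact: val_inj.
  by apply/finite_image/finite_setX; exact: pa_finite.
apply: sub_finite_set ffg => p /= nz; apply: contrapT => np.
move/eqP: nz; apply; rewrite /pa_conv big1 // => i _; apply/eqP.
rewrite mulf_eq0; apply: contrapT => /negP; rewrite negb_or => /andP[fi gi].
apply: np; exists (ptake i p, pdrop i p) => //.
by rewrite /parrows /pstart /= cat_take_drop -surjective_pairing.
Qed.
Definition pa_mul f g : path_alg := PathAlg (pa_conv_fin f g).

Fact pa_mulA : associative pa_mul.
Proof.
move=> f g h; apply: pa_eq => p /=; rewrite /pa_conv.
pose F i l := f (ptake i p) * g (pdrop i (ptake l p)) * h (pdrop l p).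
transitivity (\sum_(0 <= i < (plength p).+1)
    \sum_(0 <= j < (plength p - i).+1) F i (i + j)%N).
  apply: eq_big_nat => i _; rewrite /= /pa_conv mulr_sumr.
  rewrite {1}/plength /parrows /= size_drop; apply: eq_big_nat => j _.
  by rewrite /F pdrop_take pdrop_drop mulrA.
rewrite sum_triangle; apply: eq_big_nat => l /andP[_ /ltnSE le_lp].
rewrite /= /pa_conv mulr_suml /plength /parrows /= size_takel //.
by apply: eq_big_nat => i /andP[_ /ltnSE le_il]; rewrite /F ptake_take.
Qed.

Fact pa_mul1l : left_id pa_one pa_mul.
Proof.
move=> f; apply: pa_eq => p; rewrite /= /pa_conv big_nat_recl // big1_seq.
  rewrite addr0 /= /plength /parrows /= take0 eqxx mul1r; congr (f _).
  by apply: qpathP; rewrite /pstart /parrows /= ?take0 ?drop0.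
move=> i /=; rewrite mem_index_iota => /andP[_ lt_ip].
by rewrite /plength /parrows /= size_takel // mul0r.
Qed.

Fact pa_mul1r : right_id pa_one pa_mul.
Proof.
move=> f; apply: pa_eq => p; rewrite /= /pa_conv big_nat_recr // big1_seq.
  have e : plength (pdrop (plength p) p) = 0%N.
    by rewrite {1}/plength {1}/parrows /= size_drop subnn.
  rewrite [LHS]add0r /= e eqxx mulr1; congr (f _).
  by apply: qpathP; rewrite // {1}/parrows /= take_size.
move=> i /=; rewrite mem_index_iota => /andP[_ lt_ip].
by rewrite {1}/plength {1}/parrows /= size_drop subn_eq0 leqNgt lt_ip mulr0.
Qed.

Fact pa_mulDl : left_distributive pa_mul +%R.
Proof.
move=> f g h; apply: pa_eq => p; rewrite pa_coefD /= /pa_conv -big_split.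
by apply: eq_bigr => i _; rewrite pa_coefD mulrDl.
Qed.

Fact pa_mulDr : right_distributive pa_mul +%R.
Proof.
move=> f g h; apply: pa_eq => p; rewrite pa_coefD /= /pa_conv -big_split.
by apply: eq_bigr => i _; rewrite pa_coefD mulrDr.
Qed.

HB.instance Definition _ := GRing.Zmodule_isPzRing.Build path_alg
  pa_mulA pa_mul1l pa_mul1r pa_mulDl pa_mulDr.

Lemma pa_coefM f g p : (f * g) p = pa_conv f g p. Proof. by []. Qed.

End PathAlgebra.

Section Gentle.
Variables (k : fieldType) (Q : quiver).
Local Notation kQ := (path_alg k Q).

Definition earrow (a : qarrow Q) : kQ := pbasis k (parrow a).

Definition composable (a b : qarrow Q) : Prop := qtgt a = qsrc b.

Definition arrow_ideal : set kQ := ideal_gen (range earrow).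

(* For composable a and b the product [earrow a * earrow b] is the path a b. *)
Definition two_paths : set kQ :=
  [set f | exists a b, composable a b /\ f = earrow a * earrow b].

(* Finiteness of Q is part of the type [quiver]. *)
Definition bound_quiver (I : set kQ) : Prop :=
  is_ideal I /\
  exists m, ideal_exp arrow_ideal m `<=` I /\ I `<=` ideal_exp arrow_ideal 2.

Record gentle (I : set kQ) : Prop := Gentle {
  gentle_bound : bound_quiver I;
  gentle_degree : forall x : qnode Q,
    (#|[pred a | qsrc a == x]| <= 2)%N /\ (#|[pred a | qtgt a == x]| <= 2)%N;
  gentle_notin : forall a : qarrow Q,
    is_subset1 [set b | composable a b /\ ~ I (earrow a * earrow b)] /\
    is_subset1 [set c | composable c a /\ ~ I (earrow c * earrow a)];
  gentle_in : forall a : qarrow Q,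
    is_subset1 [set b | composable a b /\ I (earrow a * earrow b)] /\
    is_subset1 [set c | composable c a /\ I (earrow c * earrow a)];
  gentle_gen : exists2 G : set kQ, G `<=` two_paths & I = ideal_gen G }.

End Gentle.

Definition covers (T : finType) (le : rel T) (x y : T) : bool :=
  [&& x != y, le x y &
      [forall z, le x z && le z y ==> (z == x) || (z == y)]].

Definition hasse_quiver (T : finType) (le : rel T) : quiver :=
  @Quiver T {e : T * T | covers le e.1 e.2}
    (fun e => (val e).1) (fun e => (val e).2).

Section Homology.
Variables (R : realType) (k : fieldType) (X : topologicalType).

Definition std_simplex (n : nat) : set 'rV[R]_n.+1 :=
  [set x | (forall i, 0 <= x ord0 i) /\ \sum_i x ord0 i = 1].
Arguments std_simplex n : clear implicits.

Definition face_vec n (i : 'I_n.+2) (x : 'rV[R]_n.+1) : 'rV[R]_n.+2 :=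
  \row_j (if unlift i j is Some j' then x ord0 j' else 0).

Fact face_proof n (i : 'I_n.+2) (x : set_type (std_simplex n)) :
  face_vec i (val x) \in std_simplex n.+1.
Proof.
have [x0 x1] := set_mem (valP x); apply/mem_set; split=> [j|].
  by rewrite mxE; case: unlift.
rewrite (bigD1_ord i) //= mxE unlift_none add0r -x1.
by apply: eq_bigr => j _; rewrite mxE liftK.
Qed.

Definition face n (i : 'I_n.+2) (x : set_type (std_simplex n)) :
    set_type (std_simplex n.+1) :=
  exist _ (face_vec i (val x)) (face_proof i x).

(* A singular n-simplex is a continuous map from the standard simplex; a chain
   is a finitely supported function vanishing off the singular simplices. *)
Definition chain (n : nat) : Type := (set_type (std_simplex n) -> X) -> k.

Definition is_chain n (A : set X) (c : chain n) : Prop :=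
  finite_set [set s | c s != 0] /\
  forall s, c s != 0 -> continuous s /\ range s `<=` A.

Definition boundary n (c : chain n.+1) : chain n := fun t =>
  \sum_(i < n.+2) (-1) ^+ i *
    \sum_(s \in [set s : set_type (std_simplex n.+1) -> X | s \o face i = t])
      c s.

Definition rel_cycle (A B : set X) (n : nat) : chain n -> Prop :=
  match n with
  | 0 => fun c => is_chain A c
  | n'.+1 => fun c => is_chain A c /\ is_chain B (boundary c)
  end.

Definition rel_boundary (A B : set X) n (c : chain n) : Prop :=
  exists2 d : chain n.+1,
    is_chain A d & is_chain B (fun s => c s - boundary d s).

Definition trivial_homology (A B : set X) : Prop :=
  forall n (c : chain n), rel_cycle A B c -> rel_boundary A B c.

End Homology.

Section Multivector.
Variables (R : realType) (k : fieldType) (X : topologicalType).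
Implicit Types (A B N S Y P E : set X) (V : set (set X)) (phi rho : int -> X).

Definition mo A : set X := closure A `\` A.
Definition locally_closed A : Prop := closed (mo A).

Definition multivector_field V : Prop :=
  [/\ (forall W, V W -> W !=set0), (\bigcup_(W in V) W = setT),
      trivIset V id & (forall W, V W -> locally_closed W)].

Definition mv_class V (x : X) : set X :=
  \bigcup_(W in [set W | V W /\ W x]) W.

Definition critical (W : set X) : Prop :=
  ~ trivial_homology R k (closure W) (mo W).

Definition mvF V (x : X) : set X := closure [set x] `|` mv_class V x.
Definition mvF_set V A : set X := \bigcup_(x in A) mvF V x.

Definition is_path V rho (a b : int) : Prop :=
  a <= b /\ forall t, a <= t < b -> mvF V (rho t) (rho (t + 1)).

Definition path_in V Y rho (a b : int) : Prop :=
  is_path V rho a b /\ forall t, a <= t <= b -> Y (rho t).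

Definition full_solution V phi : Prop :=
  forall t, mvF V (phi t) (phi (t + 1)).

Definition essential V phi : Prop :=
  let ok r t := mv_class V (phi r) <> mv_class V (phi t) \/
                critical (mv_class V (phi r)) in
  full_solution V phi /\
  forall t, (exists2 s, t < s & ok s t) /\ (exists2 s, s < t & ok s t).

Definition Inv V A : set X :=
  [set x | A x /\
     exists phi, [/\ essential V phi, range phi `<=` A & range phi x]].

Definition isolating_block V N : Prop :=
  forall x y z, N x -> N z -> mvF V x y -> mvF V y z -> N y.

Definition uim_minus phi : set X :=
  \bigcap_(t in [set t : int | t < 0]) (phi @` [set s | s <= t]).
Definition uim_plus phi : set X :=
  \bigcap_(t in [set t : int | 0 < t]) (phi @` [set s | t <= s]).

(* [le q p] reads [q <= p]: paths descend in the order. *)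
Definition admissible_order V S (I : Type) (B : I -> set X) (le : rel I) :
    Prop :=
  [/\ reflexive le, antisymmetric le, transitive le &
    forall rho a b p q, path_in V S rho a b -> B p (rho a) -> B q (rho b) ->
      (p <> q /\ le q p) \/
      (p = q /\ forall t, a <= t <= b -> B p (rho t))].

Record block_decomposition V S (I : Type) (B : I -> set X) : Prop :=
  BlockDecomposition {
    bd_nonempty : forall p, B p !=set0;
    bd_disjoint : trivIset setT B;
    bd_sub : forall p, B p `<=` S;
    bd_isolating : forall p, isolating_block V (B p);
    bd_uim : forall phi, essential V phi -> range phi `<=` S ->
      (exists p, uim_minus phi `<=` B p) /\ (exists q, uim_plus phi `<=` B q);
    bd_order : exists le : rel I, admissible_order V S B le }.

(* The least admissible order. *)
Definition flow_le V S (I : Type) (B : I -> set X) (p q : I) : Prop :=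
  forall le : rel I, admissible_order V S B le -> le p q.

Definition flow_lt V S (I : Type) (B : I -> set X) (p q : I) : Prop :=
  p <> q /\ flow_le V S B p q.

(* A pair of sets stands for a pair (P, E); index pairs satisfy E `<=` P. *)
Definition index_pair V S (PE : set X * set X) : Prop :=
  let: (P, E) := PE in
  [/\ closed P, closed E & E `<=` P] /\
  [/\ mvF_set V (P `\` E) `<=` P, mvF_set V E `&` P `<=` E &
      S = Inv V (P `\` E)].

Definition index_triple V (Ba Br B N0 N1 N2 : set X) : Prop :=
  let BB (b : bool) := if b then Br else Ba in
  [/\ isolating_block V B, block_decomposition V B BB &
      ~ flow_lt V B BB true false] /\
  [/\ closed N0, closed N1, closed N2, N0 `<=` N1 & N1 `<=` N2] /\
  [/\ index_pair V (Inv V Ba) (N1, N0), index_pair V (Inv V Br) (N2, N1) &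
      index_pair V (Inv V B) (N2, N0)] /\
  [/\ Ba `<=` N1 `\` N0, Br `<=` N2 `\` N1 & B `<=` N2 `\` N0].

Definition pf V A Y : set X :=
  [set y | exists rho a b, [/\ path_in V Y rho a b, A (rho a) & y = rho b]].

(* The five inner terms of the connecting sequence from [PE] to [PE']. *)
Definition connecting V B (PE PE' : set X * set X) (i : 'I_5) :
    set X * set X :=
  let clB := closure B in
  let moB := mo B in
  let: (P, E) := PE in
  let: (P', E') := PE' in
  match val i with
  | 0 => (pf V clB P, E `&` pf V moB P)
  | 1 => (pf V clB P, pf V moB P)
  | 2 => (clB, moB)
  | 3 => (pf V clB P', pf V moB P')
  | _ => (pf V clB P', E' `&` pf V moB P')
  end.

Definition mv_refines V V' : Prop :=
  forall W, V W -> exists2 W', V' W' & W `<=` W'.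

Definition blocks_refine (I J : Type) (B : I -> set X) (B' : J -> set X) :
    Prop :=
  forall p, exists q, B p `<=` B' q.

(* Of the two columns l, l.+1 of step l, the one selected by b. *)
Definition col (l : nat) (b : bool) : nat := if b then l.+1 else l.

(* Only the columns l <= zz_len are meaningful; [zz_up l] tells whether the
   coarser column of step l is l.+1, so the coarser column is
   [col l (zz_up l)] and the finer one [col l (~~ zz_up l)]. *)
Record zigzag := Zigzag {
  zz_len : nat;
  zz_mv : nat -> set (set X);
  zz_idx : nat -> finType;
  zz_blk : forall l, zz_idx l -> set X;
  zz_up : nat -> bool;
  zz_mvP : forall l, (l <= zz_len)%N -> multivector_field (zz_mv l);
  zz_blkP : forall l, (l <= zz_len)%N ->
    block_decomposition (zz_mv l) setT (@zz_blk l);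
  zz_stepP : forall l, (l < zz_len)%N ->
    mv_refines (zz_mv (col l (~~ zz_up l))) (zz_mv (col l (zz_up l))) /\
    blocks_refine (@zz_blk (col l (~~ zz_up l))) (@zz_blk (col l (zz_up l))) }.

Definition zz_fine (Z : zigzag) (l : nat) : nat := col l (~~ zz_up Z l).
Definition zz_coarse (Z : zigzag) (l : nat) : nat := col l (zz_up Z l).

(* The fibre over q of the indexing map of step l: blocks being non-empty and
   disjoint, the index of the block containing B_p is unique. *)
Definition zz_fibre (Z : zigzag) (l : nat) (q : zz_idx Z (zz_coarse Z l)) :
    pred (zz_idx Z (zz_fine Z l)) :=
  [pred p | `[< zz_blk p `<=` zz_blk q >]].

Definition basic (Z : zigzag) : Prop :=
  forall l (q : zz_idx Z (zz_coarse Z l)), (l < zz_len Z)%N ->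
    (#|zz_fibre q| <= 2)%N.

(* Z' arises from Z by replacing each step l with a sequence of steps from
   column tau l to column tau l.+1 in the same direction, which all except the
   coarsest term carry the finer multivector field of step l. *)
Definition ar_cascades (Z Z' : zigzag) : Prop :=
  exists tau : nat -> nat,
    [/\ tau 0%N = 0%N, tau (zz_len Z) = zz_len Z',
        forall l, (l < zz_len Z)%N -> (tau l < tau l.+1)%N,
        forall l, (l <= zz_len Z)%N -> zz_mv Z' (tau l) = zz_mv Z l /\
          range (@zz_blk Z' (tau l)) = range (@zz_blk Z l) &
        forall l m, (l < zz_len Z)%N -> (tau l <= m < tau l.+1)%N ->
          zz_up Z' m = zz_up Z l /\
          zz_mv Z' (zz_fine Z' m) = zz_mv Z (zz_fine Z l)].

(* The basic filtration underlying the transition diagrams for Z. *)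
Definition basic_form (Z Z' : zigzag) : Prop :=
  basic Z' /\ ((basic Z /\ Z' = Z) \/ (~ basic Z /\ ar_cascades Z Z')).

(* An inl node is the position of the index pair given to a block in column l
   or l.+1 by transition step l; an inr node is the position of an inner term of
   the connecting sequence of a block in column m.+1. *)
Definition td_node (Z : zigzag) : finType :=
  ({s : 'I_(zz_len Z) * bool & zz_idx Z (col s.1 s.2)} +
   {m : 'I_(zz_len Z).-1 & (zz_idx Z m.+1 * 'I_5)%type})%type.

Section TransitionDiagram.
Variable Z : zigzag.

Definition step_node (l : 'I_(zz_len Z)) (b : bool) (p : zz_idx Z (col l b)) :
    td_node Z :=
  inl (existT (fun s : 'I_(zz_len Z) * bool => zz_idx Z (col s.1 s.2))
         (l, b) p).

Definition fine_node (l : 'I_(zz_len Z)) (p : zz_idx Z (zz_fine Z l)) :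
  td_node Z := @step_node l (~~ zz_up Z l) p.
Definition coarse_node (l : 'I_(zz_len Z)) (q : zz_idx Z (zz_coarse Z l)) :
  td_node Z := @step_node l (zz_up Z l) q.

Definition align_node (m : 'I_(zz_len Z).-1) (p : zz_idx Z m.+1) (i : 'I_5) :
    td_node Z :=
  inr (existT (fun m : 'I_(zz_len Z).-1 => (zz_idx Z m.+1 * 'I_5)%type)
         m (p, i)).

(* Steps m and m.+1, which surround column m.+1. *)
Definition step_before (m : 'I_(zz_len Z).-1) : 'I_(zz_len Z) :=
  widen_ord (leq_pred _) m.

Fact step_after_proof (m : 'I_(zz_len Z).-1) : (m.+1 < zz_len Z)%N.
Proof. by case: m => m /=; case: (zz_len Z). Qed.
Definition step_after (m : 'I_(zz_len Z).-1) : 'I_(zz_len Z) :=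
  Ordinal (step_after_proof m).

Definition left_node (m : 'I_(zz_len Z).-1) (p : zz_idx Z m.+1) : td_node Z :=
  @step_node (step_before m) true p.
Definition right_node (m : 'I_(zz_len Z).-1) (p : zz_idx Z m.+1) : td_node Z :=
  @step_node (step_after m) false p.

End TransitionDiagram.

(* The shape of a fibre of an indexing map: [Split a r] for {a, r} with a the
   attracting and r the repelling index; [Carry p b] for {p}, where b selects
   the direction of the equality arrow; [Birth] for the empty fibre. *)
Variant fibre_case (I : Type) :=
  | Split of I & I
  | Carry of I & bool
  | Birth.
Arguments Birth {I}.

Record transition_diagram (Z : zigzag) := TransitionDiagram {
  td_pair : td_node Z -> set X * set X;
  td_case : forall l : 'I_(zz_len Z),
    zz_idx Z (zz_coarse Z l) -> fibre_case (zz_idx Z (zz_fine Z l));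
  td_stepP : forall (l : 'I_(zz_len Z)) (q : zz_idx Z (zz_coarse Z l)),
    let V := zz_mv Z (zz_fine Z l) in
    let V' := zz_mv Z (zz_coarse Z l) in
    let PE := td_pair (coarse_node q) in
    index_pair V' (Inv V' (zz_blk q)) PE /\
    match td_case q with
    | Split a r =>
        [/\ a != r, zz_fibre q =i pred2 a r &
          exists N0 N1 N2 : set X,
            [/\ index_triple V (zz_blk a) (zz_blk r) (zz_blk q) N0 N1 N2,
                td_pair (fine_node a) = (N1, N0),
                td_pair (fine_node r) = (N2, N1) &
                PE = (N2, N0)]]
    | Carry p _ =>
        [/\ zz_fibre q =i pred1 p, index_pair V (Inv V (zz_blk p)) PE,
            zz_blk q `<=` PE.1 `\` PE.2 &
            td_pair (fine_node p) = PE]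
    | Birth =>
        zz_fibre q =i pred0 /\ zz_blk q `<=` PE.1 `\` PE.2
    end;
  td_alignP : forall (m : 'I_(zz_len Z).-1) (p : zz_idx Z m.+1) (i : 'I_5),
    td_pair (align_node p i) =
    connecting (zz_mv Z m.+1) (zz_blk p)
      (td_pair (left_node p)) (td_pair (right_node p)) i }.

Section Diagram.
Variables (Z : zigzag) (D : transition_diagram Z).

(* The arrows are the inclusions of the AR-split diagrams (two arrows and their
   composite), the equalities, and the inclusions of the connecting sequences
   left > 0 < 1 > 2 < 3 > 4 < right read as in [connecting]. *)
Variant td_arrow : td_node Z -> td_node Z -> Prop :=
  | TDsub (l : 'I_(zz_len Z)) (q : zz_idx Z (zz_coarse Z l)) a r
      of td_case D q = Split a r :
      td_arrow (fine_node a) (coarse_node q)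
  | TDquo (l : 'I_(zz_len Z)) (q : zz_idx Z (zz_coarse Z l)) a r
      of td_case D q = Split a r :
      td_arrow (coarse_node q) (fine_node r)
  | TDcomp (l : 'I_(zz_len Z)) (q : zz_idx Z (zz_coarse Z l)) a r
      of td_case D q = Split a r :
      td_arrow (fine_node a) (fine_node r)
  | TDfw (l : 'I_(zz_len Z)) (q : zz_idx Z (zz_coarse Z l)) p
      of td_case D q = Carry p true :
      td_arrow (fine_node p) (coarse_node q)
  | TDbw (l : 'I_(zz_len Z)) (q : zz_idx Z (zz_coarse Z l)) p
      of td_case D q = Carry p false :
      td_arrow (coarse_node q) (fine_node p)
  | TDleft (m : 'I_(zz_len Z).-1) (p : zz_idx Z m.+1) :
      td_arrow (align_node p ord0) (left_node p)
  | TDright (m : 'I_(zz_len Z).-1) (p : zz_idx Z m.+1) :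
      td_arrow (align_node p ord_max) (right_node p)
  | TDalign (m : 'I_(zz_len Z).-1) (p : zz_idx Z m.+1) (i j : 'I_5)
      of (val i, val j) \in [:: (0, 1); (2, 1); (2, 3); (4, 3)]%N :
      td_arrow (align_node p i) (align_node p j).

(* [connect] is the reflexive transitive closure. *)
Definition td_le : rel (td_node Z) := connect (fun x y => `[< td_arrow x y >]).

Definition td_quiver : quiver := hasse_quiver td_le.

Definition ar_split (x y z : td_node Z) : Prop :=
  exists (l : 'I_(zz_len Z)) (q : zz_idx Z (zz_coarse Z l)) a r,
    td_case D q = Split a r /\
    [/\ x = fine_node a, y = coarse_node q & z = fine_node r].

Definition td_ideal : set (path_alg k td_quiver) :=
  ideal_gen [set f | exists a b : qarrow td_quiver,
    [/\ composable a b, ar_split (qsrc a) (qtgt a) (qtgt b) &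
        f = earrow k a * earrow k b]].

End Diagram.

End Multivector.
Arguments td_ideal {R k X Z} D _.

(* Main.v *)
Require Import Defs.
From mathcomp Require Import all_boot all_order all_algebra.
From mathcomp Require Import boolp classical_sets functions cardinality.
From mathcomp Require Import reals topology.
Import Defs.

Set Implicit Arguments.
Unset Strict Implicit.
Unset Printing Implicit Defensive.

Import GRing.Theory.
Local Open Scope classical_set_scope.
Local Open Scope ring_scope.

(** Which arrows survive in the Hasse diagram can be read off the transition
    diagram: a composite (N1, N0) -> (N2, N1) of an AR-split is not a cover,
    because (N2, N0) lies between its ends ([covers_hasse_arrow]). What remains
    are the two arrows of each AR-split, the equality arrow of each carried
    block, both between the positions of one transition step, and the zigzags
    left > 0 < 1 > 2 < 3 > 4 < right of the connecting sequences.

    The blocks of a column are disjoint, so the fibres of an indexing map are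
    disjoint, and a node is the source of at most one and the target of at most
    one arrow of a transition step; two such arrows in a row can only be the two
    arrows of an AR-split ([step_arrow_split]). A connecting sequence alternates
    its directions; its two outer arrows lead into positions of transition
    steps, and each position is reached by at most one such arrow. Hence an
    arrow that follows another one belongs to a transition step
    ([hasse_arrow_next]), from which everything needed is visible:
    - at most two arrows start, and at most two end, at a node;
    - an arrow has at most one successor, hence at most one inside the ideal
      and at most one outside;
    - an arrow with predecessors starts at a position of a transition step,
      where at most one arrow of the same step ends, with which it composes to
      an AR-split, and at most one arrow of a connecting sequence ends, with
      which it does not;
    - there is no path of length four, since its last three arrows would belong
      to transition steps; so the fourth power of the arrow ideal is zero.

    Membership in the ideal is translated into a condition on pairs of arrows
    by [relation_idealP]: the ideal is monomial, so it contains a path of length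
    two only if that path is one of its generators. *)

(** * Ideals generated by relations of length two *)

Lemma ideal_gen_ideal (A : pzRingType) (G : set A) : is_ideal (ideal_gen G).
Proof.
split=> [J [[]//]|x y Gx Gy J JG|a x Gx].
  by have [[_ JD _] _] := JG; apply: JD; [exact: Gx|exact: Gy].
by split=> J JG; have [[_ _ JM] _] := JG; have [] := JM a x (Gx J JG).
Qed.

Section SupportIdeals.
Variables (k : fieldType) (Q : quiver).
Local Notation kQ := (path_alg k Q).

Definition supported (P : set (qpath Q)) : set kQ :=
  [set f | forall p, f p != 0 -> P p].

Lemma pa_coefM_neq0 (f g : kQ) p : (f * g) p != 0 ->
  exists i, [/\ (i <= plength p)%N, f (ptake i p) != 0 & g (pdrop i p) != 0].
Proof.
move=> nz; apply: contrapT => none; move/eqP: nz; apply.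
rewrite pa_coefM /pa_conv big_nat big1 // => i /andP[_ /ltnSE le_ip].
apply/eqP; rewrite mulf_eq0; apply: contrapT => /negP.
by rewrite negb_or => /andP[fi gi]; apply: none; exists i.
Qed.

(** A path with a non-zero coefficient in a product splits into a path from the
    support of each factor, so it lengthens a path in [P] if one of the factors
    is supported in [P]. *)
Lemma supported_ideal (P : set (qpath Q)) :
  (forall i p, P (ptake i p) -> P p) -> (forall i p, P (pdrop i p) -> P p) ->
  is_ideal (supported P).
Proof.
move=> Pt Pd; split=> [p|f g Pf Pg p|a f Pf]; first by rewrite eqxx.
- rewrite pa_coefD => nz; have [f0|] := eqVneq (f p) 0; last exact: Pf.
  by apply: Pg; move: nz; rewrite f0 add0r.
- by split=> p /pa_coefM_neq0[i [_ l r]]; [exact/Pd/Pf/r|exact/Pt/Pf/l].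
Qed.

Lemma earrow_supp a (p : qpath Q) : earrow k a p != 0 -> p = parrow a.
Proof.
rewrite /earrow /=; case: (eqVneq (parrow a) p) => [->//|_].
by rewrite eqxx.
Qed.

Lemma earrow2_supp a b (p : qpath Q) :
  (earrow k a * earrow k b) p != 0 -> parrows p = [:: a; b].
Proof.
move=> /pa_coefM_neq0[i [_ /earrow_supp ea /earrow_supp eb]].
rewrite -(cat_take_drop i (parrows p)).
rewrite -[take _ _]/(parrows (ptake i p)) -[drop _ _]/(parrows (pdrop i p)).
by rewrite ea eb.
Qed.

Lemma earrow2_neq0 a b : composable a b ->
  exists p : qpath Q, (earrow k a * earrow k b) p != 0.
Proof.
move=> ab; have wab : walk (qsrc a) [:: a; b] by rewrite /= eqxx ab eqxx.
pose p := @QPath Q (qsrc a, [:: a; b]) wab; exists p.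
have e0 : ptake 0 p == parrow a = false by apply/negP => /eqP[].
have e1 : ptake 1 p = parrow a by exact: qpathP.
have e2 : ptake 2 p == parrow a = false by apply/negP => /eqP[].
have d1 : pdrop 1 p = parrow b by exact: qpathP.
rewrite pa_coefM /pa_conv /= !big_nat_recl // big_geq //.
rewrite /= -!(eq_sym (ptake _ p)) -(eq_sym (pdrop 1 p)) e0 e1 e2 d1 !eqxx.
by rewrite !mul0r add0r !addr0 mulr1 oner_neq0.
Qed.

(** The arrow ideal consists of combinations of non-trivial paths, and each
    further factor of it adds an arrow. *)
Lemma ideal_exp_supp m :
  ideal_exp (@arrow_ideal k Q) m `<=` supported [set p | m <= plength p]%N.
Proof.
have gei n : is_ideal (supported [set p | n <= plength p]%N).
  apply: supported_ideal => i p /= /leq_trans; apply.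
    by rewrite /plength /parrows /= size_take_min geq_minr.
  by rewrite /plength /parrows /= size_drop leq_subr.
have J1 : (@arrow_ideal k Q) `<=` supported [set p | 1 <= plength p]%N.
  apply: smallest_sub; first exact: gei.
  by move=> _ [a _ <-] p /earrow_supp ->.
elim: m => [|m IH] //; apply: smallest_sub; first exact: gei.
move=> _ [x [y [/J1 Jx /IH Jy ->]]] p /pa_coefM_neq0[i [_ /Jx xi /Jy yi]] /=.
rewrite {}/plength in xi yi *.
rewrite -(cat_take_drop i (parrows p)) size_cat.
exact: (leq_add xi yi).
Qed.

Definition relation_ideal (S : qarrow Q -> qarrow Q -> Prop) : set kQ :=
  ideal_gen [set f | exists a b,
    [/\ composable a b, S a b & f = earrow k a * earrow k b]].

(** The relation ideal is monomial: it is supported on the paths that run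
    through one of its relations, and the only such path of length two is the
    relation itself. *)
Lemma relation_idealP (S : qarrow Q -> qarrow Q -> Prop) a b :
  composable a b -> relation_ideal S (earrow k a * earrow k b) <-> S a b.
Proof.
move=> ab; split=> [Iab|Sab]; last first.
  by move=> J [_ GJ]; apply: GJ; exists a, b.
pose P := [set p : qpath Q | exists c d, S c d /\ infix [:: c; d] (parrows p)].
have PI : is_ideal (supported P).
  apply: supported_ideal => i p [c [d [Scd cd]]]; exists c, d; split=> //.
    by apply: infix_trans cd _; exact: infix_take.
  by apply: infix_trans cd _; exact: infix_drop.
have [p nz] := earrow2_neq0 ab.
have /(_ p nz)[c [d [Scd]]] : supported P (earrow k a * earrow k b).
  apply: (Iab (supported P)); split=> // _ [c [d [_ Scd ->]]] q.
  by move=> /earrow2_supp eq; exists c, d; rewrite eq infix_refl.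
rewrite (earrow2_supp nz).
by rewrite !infix_consl infixs0 /= !andbF !orbF !andbT => /andP[/eqP<- /eqP<-].
Qed.

End SupportIdeals.

(** The ideal contains all paths of length [n] because there are none, and
    membership of a path of length two is decided by [S], so that the
    conditions on the ideal become conditions on [S]. *)
Lemma relation_ideal_gentle (k : fieldType) (Q : quiver)
    (S : qarrow Q -> qarrow Q -> Prop) (n : nat) :
  (forall p : qpath Q, plength p < n)%N ->
  (forall x : qnode Q,
    (#|[pred a | qsrc a == x]| <= 2)%N /\ (#|[pred a | qtgt a == x]| <= 2)%N) ->
  (forall a : qarrow Q, is_subset1 [set b | composable a b /\ ~ S a b] /\
    is_subset1 [set c | composable c a /\ ~ S c a]) ->
  (forall a : qarrow Q, is_subset1 [set b | composable a b /\ S a b] /\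
    is_subset1 [set c | composable c a /\ S c a]) ->
  gentle (relation_ideal (k := k) S).
Proof.
move=> short deg notin isin.
have SI := @relation_idealP k Q S.
split=> [|//|a|a|].
- have RI : is_ideal (relation_ideal (k := k) S) by exact: ideal_gen_ideal.
  split=> //; exists n; split=> [f /ideal_exp_supp fn|].
    suff -> : f = 0 by have [] := RI.
    apply: pa_eq => p; apply/eqP; apply: contrapT => /negP /fn /=.
    by rewrite leqNgt short.
  apply: smallest_sub; first exact: ideal_gen_ideal.
  move=> _ [a [b [_ _ ->]]]; have inJ c : @arrow_ideal k Q (earrow k c).
    by apply: sub_gen_smallest; exists c.
  apply: sub_gen_smallest; exists (earrow k a), (earrow k b).
  split=> //; apply: sub_gen_smallest; exists (earrow k b), 1.
  by rewrite mulr1.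
- have [n1 n2] := notin a.
  split=> [b b' [ab nb] [ab' nb']|c c' [ca nc] [ca' nc']].
    by apply: n1; split=> //; rewrite -SI.
  by apply: n2; split=> //; rewrite -SI.
- have [n1 n2] := isin a.
  split=> [b b' [ab nb] [ab' nb']|c c' [ca nc] [ca' nc']].
    by apply: n1; split=> //; rewrite -SI.
  by apply: n2; split=> //; rewrite -SI.
- exists [set f | exists a b,
    [/\ composable a b, S a b & f = earrow k a * earrow k b]] => //.
  by move=> f [a [b [ab _ ->]]]; exists a, b.
Qed.

(** * Covers of a reachability relation *)

Section Covers.
Variables (T : finType) (e : rel T).

Lemma covers_connect_between x y z : covers (connect e) x y ->
  connect e x z -> connect e z y -> z = x \/ z = y.
Proof.
case/and3P=> _ _ /forallP/(_ z)/implyP nb xz zy.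
by move: nb; rewrite xz zy => /(_ isT)/orP[/eqP|/eqP]; [left|right].
Qed.

(** The first step of a walk from [x] to [y] that leaves [x] ends between [x]
    and [y], hence at [y]. *)
Lemma covers_connect_step x y : covers (connect e) x y -> e x y.
Proof.
move=> cxy; case/and3P: (cxy) => xy /connectP[s es ey] _; move: xy ey es.
elim: s => [|z s IH] /= xy ey; first by rewrite ey eqxx in xy.
case/andP=> exz pzs; have czy : connect e z y by apply/connectP; exists s.
have [zx|<-//] := covers_connect_between cxy (connect1 exz) czy.
by subst; apply: IH.
Qed.

End Covers.

(** The classes need not be disjoint or lie in [A], so that the arrows at a node
    can be sorted by their kind alone. *)
Lemma card_le2_cover (T : finType) (A : pred T) (C : bool -> set T) :
  (forall x, A x -> exists b, C b x) -> (forall b, is_subset1 (C b)) ->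
  (#|A| <= 2)%N.
Proof.
move=> AC C1; rewrite leqNgt; apply/card_gt2P.
move=> [x [y [z [[/AC[b bx] /AC[c cy] /AC[d dz]] [/eqP xy /eqP yz /eqP zx]]]]].
case: b c d bx cy dz => [] [] [] bx cy dz;
  by [apply: xy; apply: C1 bx cy|apply: yz; apply: C1 cy dz
     |apply: zx; apply: C1 dz bx].
Qed.

(** * The arrows of a transition step *)

Section Diagram.
Variables (R : realType) (k : fieldType) (X : topologicalType).
Variables (Z : zigzag R k X) (D : transition_diagram Z).
Local Notation node := (td_node Z).
Local Notation up := (zz_up Z).
Local Notation step := ('I_(zz_len Z)).

Lemma inl_eq (A B : Type) (a a' : A) : inl a = inl a' :> A + B -> a = a'.
Proof. by case. Qed.

Lemma inr_eq (A B : Type) (b b' : B) : inr b = inr b' :> A + B -> b = b'.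
Proof. by case. Qed.

Lemma step_node_inj (l l' : step) b b' (p : zz_idx Z (col l b))
    (p' : zz_idx Z (col l' b')) : step_node p = step_node p' ->
  existT (fun s : step * bool => zz_idx Z (col s.1 s.2)) (l, b) p =
  existT (fun s : step * bool => zz_idx Z (col s.1 s.2)) (l', b') p'.
Proof. exact: inl_eq. Qed.

Lemma fine_node_inj (l l' : step) (p : zz_idx Z (zz_fine Z l))
    (p' : zz_idx Z (zz_fine Z l')) : fine_node p = fine_node p' ->
  Tagged (fun l : step => zz_idx Z (zz_fine Z l)) p =
  Tagged (fun l : step => zz_idx Z (zz_fine Z l)) p'.
Proof.
move=> e0; have e := step_node_inj e0; case: (congr1 tag e) => el _.
move: p' e {e0}; case: _ / el => p' e.
by congr Tagged; apply: eq_from_Tagged e.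
Qed.

Lemma coarse_node_inj (l l' : step) (q : zz_idx Z (zz_coarse Z l))
    (q' : zz_idx Z (zz_coarse Z l')) : coarse_node q = coarse_node q' ->
  Tagged (fun l : step => zz_idx Z (zz_coarse Z l)) q =
  Tagged (fun l : step => zz_idx Z (zz_coarse Z l)) q'.
Proof.
move=> e0; have e := step_node_inj e0; case: (congr1 tag e) => el _.
move: q' e {e0}; case: _ / el => q' e.
by congr Tagged; apply: eq_from_Tagged e.
Qed.

Lemma fine_neq_coarse (l l' : step) (p : zz_idx Z (zz_fine Z l))
    (q : zz_idx Z (zz_coarse Z l')) : fine_node p <> coarse_node q.
Proof. by case=> -> e; case: (up l') e. Qed.

Definition involves (I : Type) (c : fibre_case I) (p : I) : Prop :=
  match c with
  | Split a r => p = a \/ p = r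
  | Carry p' _ => p = p'
  | Birth => False
  end.

Lemma involves_fibre (l : step) (q : zz_idx Z (zz_coarse Z l)) p :
  involves (td_case D q) p -> zz_blk p `<=` zz_blk q.
Proof.
have fibreE p' : (p' \in zz_fibre q) = `[< zz_blk p' `<=` zz_blk q >] by [].
have [_] := td_stepP D q; case: (td_case D q) => [a r|p' d|//] /=.
  move=> [_ Ef _] par; apply/asboolP; rewrite -fibreE Ef !inE.
  by case: par => ->; rewrite eqxx ?orbT.
by move=> [Ef _ _ _] ->; apply/asboolP; rewrite -fibreE Ef inE.
Qed.

Lemma zz_side_le (l : step) b : (col l b <= zz_len Z)%N.
Proof. by case: b => //=; apply: ltnW. Qed.

(** The blocks of the coarse column are disjoint, so that a block of the fine
    column lies in at most one fibre. *)
Lemma involves_uniq (l : step) (q q' : zz_idx Z (zz_coarse Z l)) p :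
  involves (td_case D q) p -> involves (td_case D q') p -> q = q'.
Proof.
move=> /involves_fibre pq /involves_fibre pq'.
have [x px] := bd_nonempty (zz_blkP (zz_side_le l (~~ up l))) p.
apply: (bd_disjoint (zz_blkP (zz_side_le l (up l)))) => //.
by exists x; split; [exact: pq|exact: pq'].
Qed.

(** The composite of an AR-split is left out, as it is not a cover. *)
Definition fibre_arrow (l : step) (q : zz_idx Z (zz_coarse Z l)) (x y : node) :
    Prop :=
  match td_case D q with
  | Split a r => x = fine_node a /\ y = coarse_node q \/
                 x = coarse_node q /\ y = fine_node r
  | Carry p true => x = fine_node p /\ y = coarse_node q
  | Carry p false => x = coarse_node q /\ y = fine_node p
  | Birth => False
  end.

Definition in_fibre (l : step) (q : zz_idx Z (zz_coarse Z l)) (x : node) :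
    Prop :=
  x = coarse_node q \/ exists2 p, involves (td_case D q) p & x = fine_node p.

Lemma in_fibre_uniq (l l' : step) (q : zz_idx Z (zz_coarse Z l))
    (q' : zz_idx Z (zz_coarse Z l')) x : in_fibre q x -> in_fibre q' x ->
  Tagged (fun l : step => zz_idx Z (zz_coarse Z l)) q =
  Tagged (fun l : step => zz_idx Z (zz_coarse Z l)) q'.
Proof.
case=> [->|[p pq ->]] [|[p' pq']].
- exact: coarse_node_inj.
- by move/esym/fine_neq_coarse.
- by move/fine_neq_coarse.
- move=> e0; have e := fine_node_inj e0; have /= el := congr1 tag e.
  move: q' p' pq' e {e0}; case: _ / el => q' p' pq' e.
  have ep := eq_from_Tagged e; subst p'.
  by congr Tagged; apply: involves_uniq pq pq'.
Qed.

(** A node determines its fibre: two arrows of transition steps that meet at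
    [u] can therefore be compared as arrows of one and the same fibre. *)
Lemma fibre_arrow_transfer (l l' : step) (q : zz_idx Z (zz_coarse Z l))
    (q' : zz_idx Z (zz_coarse Z l')) u x y :
  in_fibre q u -> in_fibre q' u -> fibre_arrow q' x y -> fibre_arrow q x y.
Proof.
move=> uq uq'; have e := in_fibre_uniq uq uq'; have /= el := congr1 tag e.
move: q' e {uq'}; case: _ / el => q' e.
by have eq := eq_from_Tagged e; subst q'.
Qed.

Lemma fibre_arrow_in (l : step) (q : zz_idx Z (zz_coarse Z l)) x y :
  fibre_arrow q x y -> in_fibre q x /\ in_fibre q y.
Proof.
rewrite /fibre_arrow /in_fibre.
case: (td_case D q) => [a r|p [] |//].
- case=> -[-> ->]; split; (by left) || right.
    by exists a => //; left.
  by exists r => //; right.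
- by case=> -> ->; split; [right; exists p|left].
- by case=> -> ->; split; [left|right; exists p].
Qed.

Lemma step_node_eq (l : step) b (p p' : zz_idx Z (col l b)) :
  step_node p = step_node p' -> p = p'.
Proof. by move=> e; exact: eq_from_Tagged (step_node_inj e). Qed.

Lemma split_neq (l : step) (q : zz_idx Z (zz_coarse Z l)) a r :
  td_case D q = Split a r -> a <> r.
Proof. by move=> Eq; have [_] := td_stepP D q; rewrite Eq => -[/eqP]. Qed.

Definition step_arrow (x y : node) : Prop :=
  exists (l : step) (q : zz_idx Z (zz_coarse Z l)), fibre_arrow q x y.

Lemma step_arrow_src_uniq y : is_subset1 [set x | step_arrow x y].
Proof.
move=> x x' [l [q qxy]] [l' [q' qxy']].
have [_ yq] := fibre_arrow_in qxy; have [_ yq'] := fibre_arrow_in qxy'.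
move/(fibre_arrow_transfer yq yq'): qxy'; move: qxy.
rewrite /fibre_arrow; case Eq: (td_case D q) => [a r|p []|//]; last 2 first.
- by move=> [-> _] [-> _].
- by move=> [-> _] [-> _].
case=> [] [-> ->] [] [-> //].
  by move/esym/fine_neq_coarse.
by move/fine_neq_coarse.
Qed.

Lemma step_arrow_tgt_uniq x : is_subset1 [set y | step_arrow x y].
Proof.
move=> y y' [l [q qxy]] [l' [q' qxy']].
have [xq _] := fibre_arrow_in qxy; have [xq' _] := fibre_arrow_in qxy'.
move/(fibre_arrow_transfer xq xq'): qxy'; move: qxy.
rewrite /fibre_arrow; case Eq: (td_case D q) => [a r|p []|//]; last 2 first.
- by move=> [_ ->] [_ ->].
- by move=> [_ ->] [_ ->].
case=> [] [-> ->] [] [+ ->] //.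
  by move/fine_neq_coarse.
by move/esym/fine_neq_coarse.
Qed.

(** A carried block has one arrow only, and of an AR-split only the two arrows
    through the coarse position can be composed. *)
Lemma step_arrow_split x y z :
  step_arrow x y -> step_arrow y z -> ar_split D x y z.
Proof.
move=> [l [q qxy]] [l' [q' qyz]].
have [_ yq] := fibre_arrow_in qxy; have [yq' _] := fibre_arrow_in qyz.
move/(fibre_arrow_transfer yq yq'): qyz; move: qxy.
rewrite /fibre_arrow; case Eq: (td_case D q) => [a r|p []|//].
- case=> -[-> ->] [] [+ ->].
  + by move/esym/fine_neq_coarse.
  + by move=> _; exists l, q, a, r.
  + by move/step_node_eq/esym/(split_neq Eq).
  + by move/fine_neq_coarse.
- by move=> [-> ->] [/esym/fine_neq_coarse].
- by move=> [-> ->] [/fine_neq_coarse].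
Qed.

Lemma ar_split_arrows x y z :
  ar_split D x y z -> step_arrow x y /\ step_arrow y z.
Proof.
move=> [l [q [a [r [Eq [-> -> ->]]]]]].
by split; exists l, q; rewrite /fibre_arrow Eq; [left|right].
Qed.

(** * The arrows of the connecting sequences *)

(** In left > 0 < 1 > 2 < 3 > 4 < right a term has at most one arrow in each of
    the two directions of the line; [d] is true for the arrows that point to
    the right. *)
Definition connecting_next (d : bool) (x : node) : option node :=
  match x with
  | inl _ => None
  | inr (existT m (p, i)) =>
    match val i, d with
    | 0, false => Some (left_node p)
    | 0, true | 2, false => Some (align_node p (@Ordinal 5 1 isT))
    | 2, true | 4, false => Some (align_node p (@Ordinal 5 3 isT))
    | 4, true => Some (right_node p)
    | _, _ => None
    end%N
  end.

Local Notation inner_block := {m : 'I_(zz_len Z).-1 & zz_idx Z m.+1}.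

Lemma align_node_inj (u u' : inner_block) i i' :
  align_node (tagged u) i = align_node (tagged u') i' -> u = u' /\ i = i'.
Proof.
case: u u' => m p [m' p'] /= e0; have e := inr_eq e0.
have /= em := congr1 tag e; move: p' e {e0}; case: _ / em => p' e.
by have [-> ->] := eq_from_Tagged e.
Qed.

Lemma left_node_inj : injective (fun u : inner_block => left_node (tagged u)).
Proof.
move=> [m p] [m' p'] /= e0; have e := step_node_inj e0.
have em : m = m'.
  by apply: val_inj; exact: (congr1 (fun u => val (tag u).1) e).
move: p' e {e0}; case: _ / em => p' e.
by congr Tagged; exact: eq_from_Tagged e.
Qed.

Lemma right_node_inj : injective (fun u : inner_block => right_node (tagged u)).
Proof.
move=> [m p] [m' p'] /= e0; have e := step_node_inj e0.
have em : m = m'.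
  by apply/val_inj/succn_inj; exact: (congr1 (fun u => val (tag u).1) e).
move: p' e {e0}; case: _ / em => p' e.
by congr Tagged; exact: eq_from_Tagged e.
Qed.

Lemma connecting_next_inj d x x' y :
  connecting_next d x = Some y -> connecting_next d x' = Some y -> x = x'.
Proof.
case: x x' => [s|[m [p i]]] // [s'|[m' [p' i']]] //.
pose u : inner_block := existT _ m p.
pose u' : inner_block := existT _ m' p'.
rewrite -[inr (existT _ m _)]/(align_node (tagged u) i).
rewrite -[inr (existT _ m' _)]/(align_node (tagged u') i').
suff uu' : connecting_next d (align_node (tagged u) i) = Some y ->
    connecting_next d (align_node (tagged u') i') = Some y ->
    u = u' /\ val i = val i'.
  by move=> e e'; have [-> /val_inj->] := uu' e e'.
(* In a fixed direction the three arrows end at two terms with different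
   numbers and at an outer position, so a common target forces [i] = [i'], and one of the three
   injectivity lemmas applies. *)
case: d i i' => [] [[|[|[|[|[|i]]]]] li] //= [[|[|[|[|[|i']]]]] li'] //=
  [<-] //;
move/(@Some_inj _ _ _) => e;
(suff -> : u' = u by []);
first [exact: (@left_node_inj u' u e) | exact: (@right_node_inj u' u e)
  | exact: (align_node_inj (u := u') (u' := u) e).1].
Qed.

Definition is_step (x : node) : bool := if x is inl _ then true else false.

(** The left end of a connecting sequence is a position in the right column of
    its step, the right end one in the left column, so a position of a step is
    an end of one of the two kinds only. *)
Lemma connecting_next_step d d' x x' y : connecting_next d x = Some y ->
  connecting_next d' x' = Some y -> is_step y -> x = x'.
Proof.
have dir e z (l : step) b (p : zz_idx Z (col l b)) :
    connecting_next e z = Some (step_node p) -> b = ~~ e.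
  case: z => [//|[m [q [[|[|[|[|[|i]]]]] li]]]] //=;
  case: e => //= /(@Some_inj _ _ _) eq;
  by have := congr1 (fun u => (tag u).2) (inl_eq eq).
case: y => // -[[l b] p] e e' _.
have bd := dir _ _ _ _ _ e; have bd' := dir _ _ _ _ _ e'.
have dd' : d = d' by apply: negb_inj; rewrite -bd -bd'.
by move: e'; rewrite -dd'; apply: connecting_next_inj.
Qed.

(** The directions alternate: the even terms are sources, the odd ones sinks. *)
Lemma connecting_next2 d d' x y : connecting_next d x = Some y ->
  connecting_next d' y = None.
Proof.
by case: x => [//|[m [p [[|[|[|[|[|i]]]]] li]]]] //=; case: d => //= -[<-].
Qed.

(** * The Hasse diagram of a transition diagram *)

Definition hasse_arrow (x y : node) : Prop :=
  step_arrow x y \/ exists d, connecting_next d x = Some y.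

Lemma step_arrow_is_step x y : step_arrow x y -> is_step x /\ is_step y.
Proof.
move=> [l [q]]; rewrite /fibre_arrow.
case: (td_case D q) => [a r|p []|//]; last 2 first.
- by move=> [-> ->].
- by move=> [-> ->].
by case=> -[-> ->].
Qed.

Lemma connecting_next_src d x y : connecting_next d x = Some y -> ~~ is_step x.
Proof. by case: x. Qed.

(** Arrows end at the sinks of connecting sequences, where no arrow starts, or
    at positions of transition steps, where only arrows of steps start. *)
Lemma hasse_arrow_next x y z :
  hasse_arrow x y -> hasse_arrow y z -> step_arrow y z.
Proof.
move=> xy [//|[d' yz]]; case: xy => [/step_arrow_is_step[_]|[d xy]].
  by move=> ys; have := connecting_next_src yz; rewrite ys.
by rewrite (connecting_next2 _ xy) in yz.
Qed.

Lemma td_arrow_cases x y : td_arrow D x y ->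
  hasse_arrow x y \/ exists z, ar_split D x z y.
Proof.
have sa (l : step) (q : zz_idx Z (zz_coarse Z l)) u v :
  fibre_arrow q u v -> hasse_arrow u v by left; exists l, q.
case=> {x y}.
- by move=> l q a r Eq; left; apply: (sa l q); rewrite /fibre_arrow Eq; left.
- by move=> l q a r Eq; left; apply: (sa l q); rewrite /fibre_arrow Eq; right.
- by move=> l q a r Eq; right; exists (coarse_node q), l, q, a, r.
- by move=> l q p Eq; left; apply: (sa l q); rewrite /fibre_arrow Eq.
- by move=> l q p Eq; left; apply: (sa l q); rewrite /fibre_arrow Eq.
- by move=> m p; left; right; exists false.
- by move=> m p; left; right; exists true.
- move=> m p i [j lj]; rewrite !inE => /or4P[]/eqP[/= ei ej]; subst j;
  left; right.
  all: [> exists true | exists false | exists true | exists false].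
  all: by rewrite /= ei; congr (Some (align_node _ _)); apply: val_inj.
Qed.

Lemma ar_split_td_arrow x y z :
  ar_split D x y z -> td_arrow D x y /\ td_arrow D y z.
Proof.
move=> [l [q [a [r [Eq [-> -> ->]]]]]].
by split; [apply: TDsub Eq|apply: TDquo Eq].
Qed.

(** The coarse position of an AR-split lies between the ends of its composite,
    so the composite is not a cover. *)
Lemma covers_hasse_arrow x y : covers (td_le D) x y -> hasse_arrow x y.
Proof.
move=> cxy; have /asboolP := covers_connect_step cxy.
case/td_arrow_cases => // -[z xzy]; have [xz zy] := ar_split_td_arrow xzy.
have cxz : td_le D x z by apply/connect1/asboolP.
have czy : td_le D z y by apply/connect1/asboolP.
case: xzy => l [q [a [r [_ [ex ez ey]]]]].
case: (covers_connect_between cxy cxz czy); rewrite ?ex ?ey ez.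
  by move/esym/fine_neq_coarse.
by move/esym/fine_neq_coarse.
Qed.

Lemma hasse_arrow_out x : exists C : bool -> set node,
  (forall y, hasse_arrow x y -> exists b, C b y) /\ forall b, is_subset1 (C b).
Proof.
case Ex: (is_step x).
  exists (fun _ => [set y | step_arrow x y]).
  split=> [y [xy|[d /connecting_next_src]]|_].
  - by exists true.
  - by rewrite Ex.
  - exact: step_arrow_tgt_uniq.
exists (fun b => [set y | connecting_next b x = Some y]); split.
  move=> y [/step_arrow_is_step[]|[d xy]]; first by rewrite Ex.
  by exists d.
by move=> b y y' /= -> [].
Qed.

Lemma hasse_arrow_in y : exists C : bool -> set node,
  (forall x, hasse_arrow x y -> exists b, C b x) /\ forall b, is_subset1 (C b).
Proof.
case Ey: (is_step y).
  exists (fun b => [set x | if b then step_arrow x y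
                            else exists d, connecting_next d x = Some y]).
  split=> [x [xy|xy]|[]];
    [by exists true|by exists false|exact: step_arrow_src_uniq|].
  by move=> x x' [d xy] [d' xy']; apply: connecting_next_step xy xy' Ey.
exists (fun b => [set x | connecting_next b x = Some y]); split.
  move=> x [/step_arrow_is_step[_]|[d xy]]; first by rewrite Ey.
  by exists d.
by move=> b x x' /=; apply: connecting_next_inj.
Qed.

Local Notation Q := (td_quiver D).

Lemma td_quiver_arrow (a : qarrow Q) : hasse_arrow (qsrc a) (qtgt a).
Proof. exact: covers_hasse_arrow (valP a). Qed.

Lemma td_quiver_arrow_eq (a b : qarrow Q) :
  qsrc a = qsrc b -> qtgt a = qtgt b -> a = b.
Proof.
move=> /= es et; apply: val_inj.
by rewrite [LHS]surjective_pairing [RHS]surjective_pairing es et.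
Qed.

Lemma td_quiver_degree (x : qnode Q) :
  (#|[pred a : qarrow Q | qsrc a == x]| <= 2)%N /\
  (#|[pred a : qarrow Q | qtgt a == x]| <= 2)%N.
Proof.
split.
  have [C [oC C1]] := hasse_arrow_out x.
  apply: (@card_le2_cover _ _
    (fun b => [set a : qarrow Q | qsrc a = x /\ C b (qtgt a)])).
    move=> a /eqP ax; have /oC[b Cb] : hasse_arrow x (qtgt a).
      by rewrite -ax; exact: td_quiver_arrow.
    by exists b.
  move=> b a a' [ax Ca] [ax' Ca']; apply: td_quiver_arrow_eq.
    by rewrite ax ax'.
  exact: C1 Ca Ca'.
have [C [oC C1]] := hasse_arrow_in x.
apply: (@card_le2_cover _ _
  (fun b => [set a : qarrow Q | qtgt a = x /\ C b (qsrc a)])).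
  move=> a /eqP ax; have /oC[b Cb] : hasse_arrow (qsrc a) x.
    by rewrite -ax; exact: td_quiver_arrow.
  by exists b.
move=> b a a' [ax Ca] [ax' Ca']; apply: td_quiver_arrow_eq.
  exact: C1 Ca Ca'.
by rewrite ax ax'.
Qed.

Lemma composable_step (a b : qarrow Q) :
  composable a b -> step_arrow (qtgt a) (qtgt b).
Proof.
move=> ab; have := td_quiver_arrow b; rewrite -ab.
exact/hasse_arrow_next/td_quiver_arrow.
Qed.

Lemma composable_next_uniq (a b b' : qarrow Q) :
  composable a b -> composable a b' -> b = b'.
Proof.
move=> ab ab'; apply: td_quiver_arrow_eq; first by rewrite -ab -ab'.
exact: step_arrow_tgt_uniq (composable_step ab) (composable_step ab').
Qed.

Definition ar_relation (a b : qarrow Q) : Prop :=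
  ar_split D (qsrc a) (qtgt a) (qtgt b).

Lemma ar_relation_src_uniq (a : qarrow Q) :
  is_subset1 [set c | composable c a /\ ar_relation c a].
Proof.
move=> c c' [ca /ar_split_arrows[sc _]] [ca' /ar_split_arrows[sc' _]].
apply: td_quiver_arrow_eq; last by rewrite ca ca'.
by rewrite ca' -ca in sc'; exact: step_arrow_src_uniq sc sc'.
Qed.

(** Two predecessors that are both arrows of connecting sequences coincide, and
    one that is an arrow of a step forms an AR-split with [a]. *)
Lemma not_ar_relation_src_uniq (a : qarrow Q) :
  is_subset1 [set c | composable c a /\ ~ ar_relation c a].
Proof.
have next c : composable c a -> ~ ar_relation c a ->
    exists d, connecting_next d (qsrc c) = Some (qsrc a).
  move=> ca nca; rewrite -ca; case: (td_quiver_arrow c) => // sc.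
  by case: nca; apply: step_arrow_split sc (composable_step ca).
move=> c c' [ca nca] [ca' nca'].
apply: td_quiver_arrow_eq; last by rewrite ca ca'.
have [d dc] := next c ca nca; have [d' dc'] := next c' ca' nca'.
apply: connecting_next_step dc dc' _; rewrite -ca.
by have [] := step_arrow_is_step (composable_step ca).
Qed.

(** Of four successive arrows the last three are arrows of steps; the middle
    one would be both the second arrow of an AR-split and the first of one. *)
Lemma td_quiver_path_short (p : qpath Q) : (plength p < 4)%N.
Proof.
rewrite ltnNge; apply/negP; rewrite /plength /parrows.
case: p => -[x [|a [|b [|c [|d s]]]]] //= w _.
have {w} [ab bc cd] : [/\ composable a b, composable b c & composable c d].
  by case/and5P: w => _ /eqP ab /eqP bc /eqP cd _; split; exact: esym.
have sb := composable_step ab; have sc := composable_step bc.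
have sd := composable_step cd.
have [l [q [a1 [r [_ [_ e _]]]]]] := step_arrow_split sb sc.
have [l' [q' [a' [r' [_ [e' _ _]]]]]] := step_arrow_split sc sd.
by apply: (@fine_neq_coarse l' l a' q); rewrite -e -e'.
Qed.

End Diagram.

Theorem proposition7p3 (R : realType) (k : fieldType) (X : topologicalType)
    (finX : finite_set [set: X]) (T0X : kolmogorov_space X)
    (ZF BF : zigzag R k X) (ZBF : basic_form ZF BF)
    (TD : transition_diagram BF) :
  gentle (td_ideal TD).
Proof.
apply: (@relation_ideal_gentle k (td_quiver TD) (@ar_relation _ _ _ _ TD) 4).
- exact: td_quiver_path_short.
- exact: td_quiver_degree.
- move=> a; split; last exact: not_ar_relation_src_uniq.
  by move=> b b' [ab _] [ab' _]; exact: composable_next_uniq ab ab'.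
- move=> a; split; last exact: ar_relation_src_uniq.
  by move=> b b' [ab _] [ab' _]; exact: composable_next_uniq ab ab'.
Qed.
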